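(* Let $a_1,\ldots,a_n$ be positive real numbers, let $\varepsilon\in(0,1)$, let $S_{1Opt},S_{2Opt}\subseteq\{1,\ldots,n\}$, and let $w,m,\delta$ be numbers satisfying $0<w\le \min\left(\sum_{i\in S_{1Opt}}a_i,\ \sum_{i\in S_{2Opt}}a_i\right)$, $n\ge m\ge \max(|S_{1Opt}|,|S_{2Opt}|)$ and $\delta=\frac{\varepsilon\cdot w}{3\cdot m}$. Put $A=(a_1,\ldots,a_n)$ and $A'=(a'_1,\ldots,a'_n)$ with $a'_i=\lfloor a_i/\delta\rfloor$. If $S_1,S_2\subseteq\{1,\ldots,n\}$ are two non-empty sets such that $w\le\min\left(\sum_{i\in S_1}a_i,\sum_{i\in S_2}a_i\right)$, $n\ge m\ge\max(|S_1|,|S_2|)$, and $1\le \mathcal{MR}(S_1,S_2,A')\le \mathcal{MR}(S_{1Opt},S_{2Opt},A')$, then $$1\le \mathcal{MR}(S_1,S_2,A)\le (1+\varepsilon)\cdot\mathcal{MR}(S_{1Opt},S_{2Opt},A).$$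
   Context: For a sequence $B=(b_1,\ldots,b_n)$ of numbers and $S,T\subseteq\{1,\ldots,n\}$, $\mathcal{R}(S,T,B)$ is defined as $0$ if $S=\emptyset$ and $T\neq\emptyset$; as $\frac{\sum_{i\in S}b_i}{\sum_{i\in T}b_i}$ if $T\ne\emptyset$; and $+\infty$ otherwise. For two sets, $\mathcal{MR}(S,T,B)=\max\{\mathcal{R}(S,T,B),\mathcal{R}(T,S,B)\}$. *)

(* Defs.v *)
From mathcomp Require Import all_boot all_order all_algebra.
From mathcomp Require Import reals constructive_ereal.

Set Implicit Arguments.
Unset Strict Implicit.
Unset Printing Implicit Defensive.

Import Order.TTheory GRing.Theory Num.Theory.

Local Open Scope ring_scope.

(* The value +oo is possible, hence the codomain \bar R.  When T is non-empty
   but its sum is 0 the paper's quotient is undefined; here it takes the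
   library value of division by 0 in R. *)
Definition ratio (R : realType) (n : nat) (S T : {set 'I_n}) (B : 'I_n -> R) :
    \bar R :=
  if (S == set0) && (T != set0) then 0%:E
  else if T != set0 then ((\sum_(i in S) B i) / (\sum_(i in T) B i))%:E
  else +oo%E.

Definition max_ratio (R : realType) (n : nat) (S T : {set 'I_n})
    (B : 'I_n -> R) : \bar R :=
  Order.max (ratio S T B) (ratio T S B).

Definition floor_scaled (R : realType) (n : nat) (delta : R) (a : 'I_n -> R) :
    'I_n -> R :=
  fun i => (Num.floor (a i / delta))%:~R.

(* Main.v *)
(* Rounding down moves a sum over at most [m] indices by at most
   [m delta = (eps / 3) w], so [delta] times a rounded sum lies within
   [(eps / 3) w] below the true sum, and [w] is below every sum involved.
   With [t := eps / 3], the error in a numerator therefore costs an additive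
   [t], and the error in a denominator a factor [1 / (1 - t)].  As the optimal
   ratio [M] is at least 1, the two losses combine to
   [M / (1 - t) + t <= (1 + 3 t) M].  Bounding both losses by factors
   would only give [1 / (1 - t) ^ 2], which exceeds [1 + 3 t] for [eps] near 1. *)

Require Import Defs.
From mathcomp Require Import all_boot all_order all_algebra.
From mathcomp Require Import reals constructive_ereal.
From mathcomp Require Import ring lra.

Import Order.TTheory GRing.Theory Num.Theory.

Local Open Scope ring_scope.

Set Implicit Arguments.
Unset Strict Implicit.

Section RealRatios.
Context {R : realFieldType}.
Implicit Types x y t w : R.

Definition maxdiv x y : R := Num.max (x / y) (y / x).

(** Lets the rounded sums be multiplied by [delta], which makes them comparable with the true
    sums. *)
Lemma maxdivM2l d x y : d != 0 -> maxdiv (d * x) (d * y) = maxdiv x y.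
Proof. by move=> d0; rewrite /maxdiv -!mulf_div divff // !mul1r. Qed.

Lemma maxdiv_ge1 x y : 0 < x -> 0 < y -> 1 <= maxdiv x y.
Proof.
move=> x0 y0; rewrite /maxdiv le_max !ler_pdivlMr // !mul1r.
exact: le_total.
Qed.

(** As [w <= y], the numerator error [t * w] adds at most [t] after division by [y]; passing to the
    smaller denominator [y'] only increases the quotient. *)
Lemma div_round_numer x y x' y' t w : 0 <= t -> w <= y -> 0 <= x' ->
  x - t * w <= x' -> 0 < y' <= y -> x / y <= x' / y' + t.
Proof.
move=> t0 wy x'0 xx' /andP[y'0 y'y]; have y0 := lt_le_trans y'0 y'y.
have H : x <= x' + t * y by have := ler_wpM2l t0 wy; lra.
apply: (@le_trans _ _ ((x' + t * y) / y)).
  by rewrite ler_wpM2r // invr_ge0 ltW.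
by rewrite mulrDl mulfK ?gt_eqF // lerD2r ler_wpM2l // lef_pV2.
Qed.

(** As [w <= y], the additive error becomes relative: [(1 - t) * y <= y']. The smaller numerator
    only helps. *)
Lemma div_round_denom x y x' y' t w : 0 <= t < 1 -> w <= y -> 0 < y ->
  0 <= x' <= x -> y - t * w <= y' -> x' / y' <= (1 - t)^-1 * (x / y).
Proof.
move=> /andP[t0 t1] wy y0 /andP[x'0 x'x] yy'.
have t'0 : 0 < 1 - t by lra.
have H : (1 - t) * y <= y' by have := ler_wpM2l t0 wy; lra.
have z0 : 0 < (1 - t) * y by rewrite mulr_gt0.
rewrite mulrCA -invfM ler_pM // ?invr_ge0.
  by rewrite (le_trans (ltW z0)).
by rewrite lef_pV2 // posrE (lt_le_trans z0).
Qed.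

Lemma maxdiv_round_numer x y x' y' t w : 0 <= t -> w <= x -> w <= y ->
  x - t * w <= x' -> y - t * w <= y' -> 0 < x' <= x -> 0 < y' <= y ->
  maxdiv x y <= maxdiv x' y' + t.
Proof.
move=> t0 wx wy xx' yy' Hx Hy; have [/andP[x'0 _] /andP[y'0 _]] := (Hx, Hy).
rewrite {1}/maxdiv ge_max; apply/andP; split.
  apply: (le_trans (div_round_numer t0 wy (ltW x'0) xx' Hy)).
  by rewrite lerD2r le_max lexx.
apply: (le_trans (div_round_numer t0 wx (ltW y'0) yy' Hx)).
by rewrite lerD2r le_max lexx orbT.
Qed.

Lemma maxdiv_round_denom x y x' y' t w : 0 <= t < 1 -> w <= x -> w <= y ->
  x - t * w <= x' -> y - t * w <= y' -> 0 < x' <= x -> 0 < y' <= y ->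
  maxdiv x' y' <= (1 - t)^-1 * maxdiv x y.
Proof.
move=> Ht wx wy xx' yy' /andP[x'0 x'x] /andP[y'0 y'y].
have t'0 : 0 <= (1 - t)^-1 by rewrite invr_ge0; case/andP: Ht => *; lra.
have [x0 y0] := (lt_le_trans x'0 x'x, lt_le_trans y'0 y'y).
have Hx : 0 <= x' <= x by rewrite x'x ltW.
have Hy : 0 <= y' <= y by rewrite y'y ltW.
rewrite {1}/maxdiv ge_max; apply/andP; split.
  apply: (le_trans (div_round_denom Ht wy y0 Hx yy')).
  by rewrite ler_wpM2l // le_max lexx.
apply: (le_trans (div_round_denom Ht wx x0 Hy xx')).
by rewrite ler_wpM2l // le_max lexx orbT.
Qed.

(** [M >= 1] absorbs the additive [t] into [t * M], which leaves [(1 - t)^-1 <= 1 + 2 * t]. *)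
Lemma round_factor_le t M : 0 <= t <= 2^-1 -> 1 <= M ->
  (1 - t)^-1 * M + t <= (1 + 3 * t) * M.
Proof.
move=> /andP[t0 t2] M1; have t'0 : 0 < 1 - t by lra.
have H : (1 - t)^-1 <= 1 + 2 * t.
  rewrite -[leLHS]mul1r ler_pdivrMr //.
  (* [(1 + 2 * t) * (1 - t) = 1 + t * (1 - 2 * t)], which is where [t <= 2^-1] enters. *)
  by have := mulr_ge0 t0 (_ : 0 <= 1 - 2 * t); nra.
have := ler_wpM2r (le_trans ler01 M1) H; nra.
Qed.

End RealRatios.

Lemma max_ratio_neq0 (R : realType) (n : nat) (S T : {set 'I_n})
    (B : 'I_n -> R) : S != set0 -> T != set0 ->
  max_ratio S T B = (maxdiv (\sum_(i in S) B i) (\sum_(i in T) B i))%:E.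
Proof.
move=> /negbTE S0 /negbTE T0; rewrite /max_ratio /Defs.ratio S0 T0 /=.
by rewrite -EFin_max.
Qed.

(** Rounding [a i] down to a multiple of [d] loses less than [d], once per index of [S]. *)
Lemma sum_floor_scaled_bounds (R : realType) (n : nat) (a : 'I_n -> R)
    (d : R) (S : {set 'I_n}) : 0 < d ->
  \sum_(i in S) a i - #|S|%:R * d
    <= d * \sum_(i in S) floor_scaled d a i <= \sum_(i in S) a i.
Proof.
move=> d0; rewrite mulr_sumr [#|S|%:R * d]mulr_natl.
rewrite -sumr_const -sumrB; apply/andP; split; apply: ler_sum => i _.
  have : a i / d < (Num.floor (a i / d) + 1)%:~R by exact: floorD1_gt.
  by rewrite ltr_pdivrMr // intrD mulrDl mul1r mulrC => /ltW; lra.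
by rewrite mulrC -ler_pdivlMr // floor_le.
Qed.

Theorem theorem1 (R : realType) (n : nat) (a : 'I_n -> R) (eps : R)
  (S1Opt S2Opt : {set 'I_n}) (w m delta : R)
  (a_gt0 : forall i, 0 < a i)
  (eps_gt0 : 0 < eps) (eps_lt1 : eps < 1)
  (w_gt0 : 0 < w)
  (w_le_opt : w <= Num.min (\sum_(i in S1Opt) a i) (\sum_(i in S2Opt) a i))
  (m_le_n : m <= n%:R)
  (opt_le_m : (maxn #|S1Opt| #|S2Opt|)%:R <= m)
  (deltaE : delta = (eps * w) / (3 * m))
  (S1 S2 : {set 'I_n})
  (S1_neq0 : S1 != set0) (S2_neq0 : S2 != set0)
  (w_le : w <= Num.min (\sum_(i in S1) a i) (\sum_(i in S2) a i))
  (card_le_m : (maxn #|S1| #|S2|)%:R <= m)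
  (MR_ge1 : (1%:E <= max_ratio S1 S2 (floor_scaled delta a))%E)
  (MR_le_opt : (max_ratio S1 S2 (floor_scaled delta a)
                <= max_ratio S1Opt S2Opt (floor_scaled delta a))%E) :
  (1%:E <= max_ratio S1 S2 a)%E /\
  (max_ratio S1 S2 a <= (1 + eps)%:E * max_ratio S1Opt S2Opt a)%E.
Proof.
have t0 : 0 < eps / 3 by rewrite divr_gt0.
have m0 : 0 < m.
  apply: lt_le_trans card_le_m; rewrite ltr0n leq_max.
  by rewrite card_gt0 S1_neq0.
have d0 : 0 < delta by rewrite deltaE divr_gt0 ?mulr_gt0.
have mdE : m * delta = eps / 3 * w.
  by rewrite deltaE; field; rewrite gt_eqF.
have bounds (S : {set 'I_n}) : w <= \sum_(i in S) a i -> #|S|%:R <= m ->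
    let F := delta * \sum_(i in S) floor_scaled delta a i in
    \sum_(i in S) a i - eps / 3 * w <= F /\ 0 < F <= \sum_(i in S) a i.
  move=> wS Sm F; have /andP[lo hi] := sum_floor_scaled_bounds a S d0.
  have H := ler_wpM2r (ltW d0) Sm.
  have lo' : \sum_(i in S) a i - eps / 3 * w <= F.
    by rewrite /F -mdE; lra.
  split=> //; apply/andP; split=> //; apply: lt_le_trans lo'.
  (* Since [w] is below the true sum, the rounded sum keeps at least [(1 - eps / 3) * w], so no
     denominator vanishes. *)
  have : 0 < (1 - eps / 3) * w by rewrite mulr_gt0 //; lra.
  by lra.
(* An empty sum cannot reach [w > 0]; hence the optimal sets are non-empty too and no ratio is
   [+oo]. *)
have neq0 (S : {set 'I_n}) : w <= \sum_(i in S) a i -> S != set0.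
  by apply: contraTneq => ->; rewrite big_set0 -ltNge.
move: w_le_opt w_le; rewrite !le_min => /andP[wO1 wO2] /andP[w1 w2].
have le_m (k l : nat) : (maxn k l)%:R <= m -> k%:R <= m /\ l%:R <= m.
  by move=> H; split; apply: le_trans H; rewrite ler_nat leq_max leqnn ?orbT.
have [/bounds-/(_ wO1) bO1 /bounds-/(_ wO2) bO2] := le_m _ _ opt_le_m.
have [/bounds-/(_ w1) b1 /bounds-/(_ w2) b2] := le_m _ _ card_le_m.
move: MR_le_opt; rewrite !max_ratio_neq0 ?neq0 // -EFinM !lee_fin => le_opt.
have gt0 (S : {set 'I_n}) : w <= \sum_(i in S) a i -> 0 < \sum_(i in S) a i.
  exact: lt_le_trans.
split; first by rewrite maxdiv_ge1 ?gt0.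
move: le_opt; rewrite -(maxdivM2l _ _ (lt0r_neq0 d0)).
rewrite -[leRHS](maxdivM2l _ _ (lt0r_neq0 d0)) => le_opt.
case: b1 b2 bO1 bO2 => [l1 h1] [l2 h2] [lO1 hO1] [lO2 hO2].
have tlt1 : 0 <= eps / 3 < 1 by apply/andP; split; lra.
(* The additive loss is charged to [S1], [S2] and the factor to the optimal pair; [le_opt] links the
   two rounded ratios. *)
have num := maxdiv_round_numer (ltW t0) w1 w2 l1 l2 h1 h2.
have den := maxdiv_round_denom tlt1 wO1 wO2 lO1 lO2 hO1 hO2.
have thalf : 0 <= eps / 3 <= 2^-1 by apply/andP; split; lra.
have := round_factor_le thalf (maxdiv_ge1 (gt0 _ wO1) (gt0 _ wO2)).
rewrite (_ : 3 * (eps / 3) = eps); last by lra.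
apply: le_trans; apply: (le_trans num); rewrite lerD2r.
exact: le_trans den.
Qed.
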